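(* Let $m\ge2$, $n\geq 2$, let $\mathcal{A}=(a_{i_1\cdots i_m})\in C^{[m,n]}$ be a complex tensor of order $m$ and dimension $n$, and let $S$ be a nonempty proper subset of $N=\{1,\ldots,n\}$. Then $$\Omega^S(\mathcal{A})\subseteq\mathcal{K}^S(\mathcal{A})\subseteq\mathcal{K}(\mathcal{A})\subseteq\Gamma(\mathcal{A}),$$ where $\Omega^S(\mathcal{A})$, $\mathcal{K}^S(\mathcal{A})$, $\mathcal{K}(\mathcal{A})$ and $\Gamma(\mathcal{A})$ are the subsets of $\mathbb{C}$ defined in the context.
   Context: A complex tensor $\mathcal{A}=(a_{i_1\cdots i_m})\in C^{[m,n]}$ of order $m$ and dimension $n$ is an array of complex numbers $a_{i_1\cdots i_m}$ with each $i_k\in N=\{1,\ldots,n\}$. No symmetry is assumed. Put $\bar S=N\setminus S$. Let $\delta_{i_1\cdots i_m}=1$ if $i_1=\cdots=i_m$ and $0$ otherwise. For $i\in N$, $$r_i(\mathcal{A})=\sum_{i_2,\ldots,i_m\in N,\ \delta_{ii_2\cdots i_m}=0}|a_{ii_2\cdots i_m}|,$$ and for $i,j\in N$, $j\ne i$, $r_i^j(\mathcal{A})=r_i(\mathcal{A})-|a_{ij\cdots j}|$. For a nonempty proper subset $T\subset N$ (here $T=S$ or $T=\bar S$), let $\Delta^N=\{(i_2,\ldots,i_m): i_k\in N \text{ for } k=2,\ldots,m\}$, $\Delta^T=\{(i_2,\ldots,i_m): i_k\in T\text{ for }k=2,\ldots,m\}$, and $\overline{\Delta^T}=\Delta^N\setminus\Delta^T$.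 For $i\in N$, $$r_i^{\Delta^T}(\mathcal{A})=\sum_{(i_2,\ldots,i_m)\in\Delta^T,\ \delta_{ii_2\cdots i_m}=0}|a_{ii_2\cdots i_m}|,\qquad r_i^{\overline{\Delta^T}}(\mathcal{A})=\sum_{(i_2,\ldots,i_m)\in\overline{\Delta^T},\ \delta_{ii_2\cdots i_m}=0}|a_{ii_2\cdots i_m}|.$$ The sets are: $\Gamma(\mathcal{A})=\bigcup_{i\in N}\Gamma_i(\mathcal{A})$, with $\Gamma_i(\mathcal{A})=\{z\in\mathbb{C}:|z-a_{i\cdots i}|\le r_i(\mathcal{A})\}$. $\mathcal{K}(\mathcal{A})=\bigcup_{i,j\in N,\ j\neq i}\mathcal{K}_{i,j}(\mathcal{A})$, with $$\mathcal{K}_{i,j}(\mathcal{A})=\left\{z\in\mathbb{C}:\left(|z-a_{i\cdots i}|-r_i^j(\mathcal{A})\right)|z-a_{j\cdots j}|\le|a_{ij\cdots j}|\,r_j(\mathcal{A})\right\}.$$ $\mathcal{K}^S(\mathcal{A})=\left(\bigcup_{i\in S,\ j\in\bar S}\mathcal{K}_{i,j}(\mathcal{A})\right)\cup\left(\bigcup_{i\in\bar S,\ j\in S}\mathcal{K}_{i,j}(\mathcal{A})\right)$. $\Omega^S(\mathcal{A})=\left(\bigcup_{i\in S,\ j\in\bar S}\Omega^S_{i,j}(\mathcal{A})\right)\cup\left(\bigcup_{i\in\bar S,\ j\in S}\Omega^{\bar S}_{i,j}(\mathcal{A})\right)$, with $$\Omega^S_{i,j}(\mathcal{A})=\left\{z\in\mathbb{C}: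 |z-a_{i\cdots i}|\left(|z-a_{j\cdots j}|-r_j^{\overline{\Delta^S}}(\mathcal{A})\right)\leq r_i(\mathcal{A})\,r_j^{\Delta^S}(\mathcal{A})\right\},$$ $$\Omega^{\bar S}_{i,j}(\mathcal{A})=\left\{z\in\mathbb{C}: |z-a_{i\cdots i}|\left(|z-a_{j\cdots j}|-r_j^{\overline{\Delta^{\bar S}}}(\mathcal{A})\right)\leq r_i(\mathcal{A})\,r_j^{\Delta^{\bar S}}(\mathcal{A})\right\}.$$ *)

(* Defs.v *)
From mathcomp Require Import all_boot all_order all_algebra.
From mathcomp Require Import classical_sets reals complex.

Set Implicit Arguments.
Unset Strict Implicit.
Unset Printing Implicit Defensive.

Import Order.TTheory GRing.Theory Num.Theory.

Local Open Scope classical_set_scope.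
Local Open Scope ring_scope.

(* The complex field is R[i]. The entry a_{i i_2 ... i_m} is [A i t], the tuple t = (i_2, ..., i_m) having
   m - 1 components. The indices 1, ..., n are shifted to 0, ..., n - 1.
   This encoding is only meaningful for 1 <= m. *)
Definition tensor (R : realType) (m n : nat) : Type :=
  'I_n -> (m.-1).-tuple 'I_n -> R[i].

Section Localization.
Variables (R : realType) (m n : nat) (A : tensor R m n).
Implicit Types (i j : 'I_n) (t : (m.-1).-tuple 'I_n) (S T : {set 'I_n}).

Definition entry_rep i j : R[i] := A i [tuple of nseq m.-1 j].

Definition diag_entry i : R[i] := entry_rep i i.

Definition kdelta i t : bool := constant (i :: t).

(* Moduli are real elements of R[i], and so is everything built from them below;
   on real elements the order of R[i] is that of R. *)
Definition row_sum i : R[i] := \sum_(t | ~~ kdelta i t) `|A i t|.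

Definition row_sum_but i j : R[i] := row_sum i - `|entry_rep i j|.

Definition Delta T : {set (m.-1).-tuple 'I_n} :=
  [set t : (m.-1).-tuple 'I_n | [forall k, tnth t k \in T]]%SET.

Definition row_sum_Delta T i : R[i] :=
  \sum_(t in Delta T | ~~ kdelta i t) `|A i t|.

Definition row_sum_DeltaC T i : R[i] :=
  \sum_(t in (~: Delta T)%SET | ~~ kdelta i t) `|A i t|.

Definition Gamma_i i : set R[i] :=
  [set z | `|z - diag_entry i| <= row_sum i].

Definition Gamma : set R[i] := \bigcup_(i in [set: 'I_n]) Gamma_i i.

Definition K_ij i j : set R[i] :=
  [set z | (`|z - diag_entry i| - row_sum_but i j) * `|z - diag_entry j|
           <= `|entry_rep i j| * row_sum j].

Definition K : set R[i] :=
  \bigcup_(i in [set: 'I_n]) \bigcup_(j in [set j | j != i]) K_ij i j.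

Definition K_S S : set R[i] :=
  (\bigcup_(i in [set` S]) \bigcup_(j in [set` (~: S)%SET]) K_ij i j) `|`
  (\bigcup_(i in [set` (~: S)%SET]) \bigcup_(j in [set` S]) K_ij i j).

Definition Omega_ij T i j : set R[i] :=
  [set z | `|z - diag_entry i| * (`|z - diag_entry j| - row_sum_DeltaC T j)
           <= row_sum i * row_sum_Delta T j].

Definition Omega_S S : set R[i] :=
  (\bigcup_(i in [set` S]) \bigcup_(j in [set` (~: S)%SET]) Omega_ij S i j) `|`
  (\bigcup_(i in [set` (~: S)%SET]) \bigcup_(j in [set` S])
     Omega_ij (~: S)%SET i j).

End Localization.

(* Main.v *)
Require Import Defs.
From mathcomp Require Import all_boot all_order all_algebra.
From mathcomp Require Import classical_sets reals complex.
From mathcomp Require Import ring.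

(** Write [x = |z - a_{i...i}|], [y = |z - a_{j...j}|], and let [p], [q] be the
    off-diagonal row sums of rows [i] and [j].  For [i != j] the moduli
    [b = |a_{ij...j}|] and [a = |a_{ji...i}|] are single terms of [p] and [q], so
    each inclusion becomes an inequality between nonnegative reals.

    The set [K_ij] lies in the union of the two discs [Gamma_i i] and
    [Gamma_i j]: if [x > p] and [y > q], then
    [(x - (p - b)) y = (x - p) y + b y > b q].

    For [Omega_S], split [q = u + v], with [u] the sum over the tuples in [T] and
    [v] the rest, where [i \in T]; then even [a <= u], because [(i, ..., i)] is a
    tuple in [T].  A point with [x (y - v) <= p u] is in [K_ij j i] when [x >= p],
    and in [K_ij i j] when [x < p] ([brauer_of_split]).  Both pairs [(i, j)] and
    [(j, i)] separate [S] from its complement, so both belong to the union that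
    defines [K_S]. *)

Set Implicit Arguments.
Unset Strict Implicit.
Unset Printing Implicit Defensive.

Import Order.TTheory GRing.Theory Num.Theory.

Local Open Scope classical_set_scope.
Local Open Scope ring_scope.

(** Both alternatives are affine in the distinguished term.  The second one holds
    for [a = u] by hypothesis, and lowering [a] to its actual value subtracts
    [(u - a) x] from the left and [(u - a) p] from the right, which preserves the
    inequality when [p <= x].  The first one is checked at the ends of [0 <= b <= p]: for [b = 0]
    it is [(x - p) y <= 0], and for [b = p] it is [x y <= p (u + v)], which
    follows from the hypothesis and [x v <= p v]. *)
Lemma brauer_of_split (F : numDomainType) (x y p u v a b : F) :
    0 <= x -> 0 <= y -> 0 <= v -> 0 <= p ->
    a <= u -> 0 <= b -> b <= p ->
    x * (y - v) <= p * u ->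
  (x - (p - b)) * y <= b * (u + v) \/ (y - ((u + v) - a)) * x <= a * p.
Proof.
move=> x0 y0 v0 p0 au b0 bp h.
have [px|xp] := real_leP (ger0_real p0) (ger0_real x0); [right|left].
  rewrite -subr_ge0.
  have -> : a * p - (y - (u + v - a)) * x
          = (p * u - x * (y - v)) + (x - p) * (u - a) by ring.
  by rewrite addr_ge0 ?mulr_ge0 ?subr_ge0.
have pp : 0 < p by apply: le_lt_trans xp.
have {}xp := ltW xp.
(* Scaling by [p] turns the interpolation weights [b / p] and [(p - b) / p]
   into [b] and [p - b]. *)
rewrite -subr_ge0 -(pmulr_rge0 _ pp).
have -> : p * (b * (u + v) - (x - (p - b)) * y)
        = b * ((p * u - x * (y - v)) + (p - x) * v) + (p - b) * ((p - x) * y)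
  by ring.
apply: addr_ge0; apply: mulr_ge0; rewrite ?mulr_ge0 ?subr_ge0 //.
by rewrite addr_ge0 ?mulr_ge0 ?subr_ge0.
Qed.

Lemma gershgorin_of_brauer (F : numDomainType) (x y p q b : F) :
    0 <= x -> 0 <= y -> 0 <= p -> 0 <= q -> 0 <= b ->
    (x - (p - b)) * y <= b * q ->
  x <= p \/ y <= q.
Proof.
move=> x0 y0 p0 q0 b0 h.
have [xp|px] := real_leP (ger0_real x0) (ger0_real p0); first by left.
have [yq|qy] := real_leP (ger0_real y0) (ger0_real q0); first by right.
have yp : 0 < y by apply: le_lt_trans qy.
have e : b * q - (x - (p - b)) * y = - ((x - p) * y + b * (y - q)) by ring.
move: h; rewrite -subr_ge0 e oppr_ge0 lt_geF //.
by rewrite ltr_wpDr ?mulr_gt0 ?mulr_ge0 ?subr_gt0 ?subr_ge0 // ltW.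
Qed.

Section Inclusions.
Variables (R : realType) (m n : nat) (A : tensor R m n).
Hypothesis hm : (2 <= m)%N.
Implicit Types (i j : 'I_n) (S T : {set 'I_n}).

(** Order at least 2 matters here: for [m = 1] the only tuple is empty, and the
    index [(i)] is diagonal. *)
Lemma kdelta_rep i j : j != i -> ~~ kdelta i [tuple of nseq m.-1 j].
Proof.
by move: hm j; case: m A => [|[|k]] //= _ _ j ji; rewrite /kdelta /= (negbTE ji).
Qed.

Lemma rep_in_Delta T i : i \in T -> [tuple of nseq m.-1 i] \in Delta m T.
Proof.
move=> iT; rewrite inE; apply/forallP => k.
by rewrite (tnth_nth i) /= nth_nseq if_same.
Qed.

Lemma row_sum_split T i :
  row_sum A i = row_sum_Delta A T i + row_sum_DeltaC A T i.
Proof.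
rewrite /row_sum (bigID (mem (Delta m T))) /=; congr (_ + _).
  by apply: eq_bigl => t; rewrite andbC.
by apply: eq_bigl => t; rewrite [t \in finset.setC _]inE andbC.
Qed.

Lemma row_sum_ge0 i : 0 <= row_sum A i.
Proof. exact: sumr_ge0. Qed.

Lemma row_sum_Delta_ge0 T i : 0 <= row_sum_Delta A T i.
Proof. exact: sumr_ge0. Qed.

Lemma row_sum_DeltaC_ge0 T i : 0 <= row_sum_DeltaC A T i.
Proof. exact: sumr_ge0. Qed.

Lemma entry_rep_le_Delta T i j :
  i \in T -> i != j -> `|entry_rep A j i| <= row_sum_Delta A T j.
Proof.
move=> iT ij; rewrite /row_sum_Delta (bigD1 [tuple of nseq m.-1 i]) /=.
  by rewrite lerDl sumr_ge0.
by rewrite rep_in_Delta ?kdelta_rep.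
Qed.

Lemma entry_rep_le_row_sum i j :
  i != j -> `|entry_rep A j i| <= row_sum A j.
Proof.
move=> ij; rewrite (row_sum_split [set i]%SET).
apply: le_trans (entry_rep_le_Delta (finset.set11 i) ij) _.
by rewrite lerDl row_sum_DeltaC_ge0.
Qed.

Lemma Omega_ij_sub T i j :
  i \in T -> i != j -> Omega_ij A T i j `<=` K_ij A i j `|` K_ij A j i.
Proof.
move=> iT ij z; rewrite /Omega_ij /K_ij /row_sum_but /setU /=.
rewrite (row_sum_split T j); apply: brauer_of_split => //.
- exact: row_sum_DeltaC_ge0.
- exact: row_sum_ge0.
- exact: entry_rep_le_Delta.
- by apply: entry_rep_le_row_sum; rewrite eq_sym.
Qed.

Lemma Omega_S_sub S : Omega_S A S `<=` K_S A S.
Proof.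
move=> z [] [i /= iT] [j /= jT] Oz.
- have ij : i != j by apply: contraTneq jT => <-; rewrite inE negbK.
  have [Kz|Kz] := Omega_ij_sub iT ij Oz; [left|right].
    by exists i => //; exists j.
  by exists j => //; exists i.
- have ij : i != j by apply: contraTneq iT => ->; rewrite inE negbK.
  have [Kz|Kz] := Omega_ij_sub iT ij Oz; [right|left].
    by exists i => //; exists j.
  by exists j => //; exists i.
Qed.

Lemma K_S_sub S : K_S A S `<=` K A.
Proof.
move=> z [] [i /= iT] [j /= jT] Kz; exists i => //; exists j => //=.
- by apply: contraTneq jT => ->; rewrite inE negbK.
- by apply: contraTneq iT => <-; rewrite inE negbK.
Qed.

Lemma K_sub_Gamma : K A `<=` Gamma A.
Proof.
move=> z [i _] [j _] Kz.
have [zi|zj] := gershgorin_of_brauer (normr_ge0 _) (normr_ge0 _)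
  (row_sum_ge0 i) (row_sum_ge0 j) (normr_ge0 _) Kz.
- by exists i.
- by exists j.
Qed.

End Inclusions.

Theorem theorem6 (R : realType) (m n : nat) (hm : (2 <= m)%N) (hn : (2 <= n)%N)
  (A : tensor R m n) (S : {set 'I_n})
  (hS0 : S != finset.set0) (hST : S \proper [set: 'I_n]%SET) :
  Omega_S A S `<=` K_S A S /\ K_S A S `<=` K A /\ K A `<=` Gamma A.
Proof.
split; first exact: Omega_S_sub.
by split; [exact: K_S_sub | exact: K_sub_Gamma].
Qed.
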